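(* Let $f \colon \mathbb{R}^n \to \mathbb{R}$, $g \colon \mathbb{R}^n \to \mathbb{R}^m$, $h \colon \mathbb{R}^n \to \mathbb{R}^p$ be continuously differentiable, let $\rho > 0$, and let $p^\rho(y) = \sum_{i=1}^n p_i^\rho(y_i)$ with each $p_i^\rho$ satisfying (P.1)--(P.3) stated in the context. Let $(x^*,y^* )$ be a stationary point of (SPOcp): $\min_{x,y} f(x) + p^\rho(y)$ s.t. $g(x) \le 0$, $h(x) = 0$, $x \circ y = 0$, $x \ge 0$, $y \ge 0$. Then there exists an $\alpha^* > 0$ such that, for all $\alpha \ge \alpha^*$, $(x^*,y^* )$ is a stationary point of (Pen($\alpha$)): $\min_{x,y} f(x) + p^\rho(y) + \alpha x^T y$ s.t. $g(x) \le 0$, $h(x) = 0$, $x \ge 0$, $y \ge 0$.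
   Context: $x \circ y$ is the componentwise product of $x,y \in \mathbb{R}^n$. ''Stationary point'' means KKT point of the respective nonlinear program (feasible, and satisfying the standard KKT conditions with some Lagrange multipliers; in (SPOcp) the $n$ constraints $x_i y_i = 0$ are treated as equality constraints). Conditions on $p_i^\rho \colon \mathbb{R} \to \mathbb{R}$: (P.1) $p_i^\rho$ is convex and attains a unique minimum at some point $s_i^\rho > 0$; (P.2) $p_i^\rho(0) - p_i^\rho(s_i^\rho) = \rho$; (P.3) $p_i^\rho$ is continuously differentiable. *)

(* Defs.v *)
From HB Require Import structures.
From mathcomp Require Import all_boot all_order all_algebra.
From mathcomp Require Import all_classical all_reals all_analysis.

Set Implicit Arguments.
Unset Strict Implicit.
Unset Printing Implicit Defensive.

Import Order.TTheory GRing.Theory Num.Theory.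
Import numFieldNormedType.Exports.

Local Open Scope classical_set_scope.
Local Open Scope ring_scope.

(* [V] is meant to be finite-dimensional: continuity of [fun x => 'd f x v] for
   every direction [v] then amounts to continuity of [x |-> 'd f x] in operator
   norm, i.e. to continuity of all partial derivatives. *)
Definition continuously_differentiable (R : realType) (V W : normedModType R)
    (f : V -> W) : Prop :=
  (forall x, differentiable f x) /\ (forall v, continuous (fun x => 'd f x v)).

(* minimize [objective z] s.t. [ineq i z <= 0] for all [i], [eqn j z = 0] for all [j] *)
Record nlp (R : realType) (V : normedModType R) (I J : finType) := NLP {
  objective : V -> R ;
  ineq : I -> V -> R ;
  eqn : J -> V -> R
}.

(* The Lagrangian equation is stated with differentials; for [V] = R^N it says
   that the corresponding combination of gradients vanishes. *)
Definition stationary (R : realType) (V : normedModType R) (I J : finType)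
    (P : nlp V I J) (z : V) : Prop :=
  [/\ (forall i, ineq P i z <= 0),
      (forall j, eqn P j z = 0) &
      exists (lam : I -> R) (mu : J -> R),
        [/\ (forall i, 0 <= lam i),
            (forall i, lam i * ineq P i z = 0) &
            forall v, 'd (objective P) z v
                      + \sum_i lam i * 'd (ineq P i) z v
                      + \sum_j mu j * 'd (eqn P j) z v = 0]].

(* The minimizer [s] is unique, so requiring [q 0 - q s = rho] under the same
   quantifier constrains the minimal value itself. *)
Definition penalty_conditions (R : realType) (rho : R) (q : R -> R) : Prop :=
  [/\ convex_function (E := R^o) setT q,
      (exists s : R, [/\ 0 < s, (forall t, t != s -> q s < q t) &
                         q 0 - q s = rho]) &
      (forall t, derivable q t 1) /\ continuous (derive1 q)].

Section problems.
Variables (R : realType) (n m p : nat).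
Variables (f : 'rV[R]_n -> R) (g : 'rV[R]_n -> 'rV[R]_m)
  (h : 'rV[R]_n -> 'rV[R]_p) (pen : 'I_n -> R -> R).

Local Notation V := ('rV[R]_n * 'rV[R]_n)%type.

(* A point is [z = (x, y)]. *)
Definition ineq_constraint (i : 'I_m + ('I_n + 'I_n)) (z : V) : R :=
  match i with
  | inl k => g z.1 0 k
  | inr (inl k) => - z.1 0 k
  | inr (inr k) => - z.2 0 k
  end.

Definition SPOcp_objective (z : V) : R := f z.1 + \sum_i pen i (z.2 0 i).

Definition SPOcp : nlp V ('I_m + ('I_n + 'I_n))%type ('I_p + 'I_n)%type :=
  NLP SPOcp_objective ineq_constraint
    (fun j z => match j with
                | inl k => h z.1 0 k
                | inr k => z.1 0 k * z.2 0 k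
                end).

Definition Pen (alpha : R) : nlp V ('I_m + ('I_n + 'I_n))%type 'I_p :=
  NLP (fun z => SPOcp_objective z + alpha * \sum_i z.1 0 i * z.2 0 i)
    ineq_constraint (fun k z => h z.1 0 k).

End problems.

(* Main.v *)
Require Import Defs.
From HB Require Import structures.
From mathcomp Require Import all_boot all_order all_algebra.
From mathcomp Require Import all_classical all_reals all_analysis.
From mathcomp Require Import ring.

Import Order.TTheory GRing.Theory Num.Theory.
Import numFieldNormedType.Exports.

Local Open Scope classical_set_scope.
Local Open Scope ring_scope.

Set Implicit Arguments.
Unset Strict Implicit.

(** The penalty term only moves the complementarity constraints from the
    constraint list into the objective: the gradient of
    [alpha * \sum_i x_i * y_i] is the combination of the gradients of the
    functions [x_i * y_i] with all coefficients [alpha], whereas the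
    Lagrangian of the constrained problem contains the same gradients with
    multipliers [gamma_i].  The difference
    [(alpha - gamma_i) * (y_i * dx_i + x_i * dy_i)] is cancelled by the
    gradients [- dx_i] and [- dy_i] of the sign constraints [- x_i <= 0] and
    [- y_i <= 0], taken with the coefficients [(alpha - gamma_i) * y_i] and
    [(alpha - gamma_i) * x_i].
    Adding these to the old multipliers of the sign constraints preserves
    - the Lagrangian equation, by construction;
    - complementary slackness, because [x_i * y_i = 0];
    - nonnegativity, because [x_i, y_i >= 0], as soon as
      [gamma_i <= alpha] for every [i].
    So any positive upper bound of the [gamma_i] is a threshold for the penalty
    parameter; [1 + \sum_i `|gamma_i|] is one.  What remains is to compute the
    differentials involved: [is_diff_fst_coord] and [is_diff_snd_coord] for the
    sign constraints, [is_diff_inner] for the penalty term, and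
    [differentiable_SPOcp_objective], by which the differential of the
    penalized objective splits into a sum. *)

Section differentials.
Variables (R : realType).

Lemma is_diff_linear (V W : normedModType R) (f : V -> W) (x : V) :
  linear f -> continuous f -> is_diff x f f.
Proof.
move=> lf cf.
pose fM := GRing.isLinear.Build _ _ _ _ _ lf.
pose fL : {linear V -> W} := HB.pack f fM.
apply: DiffDef; first exact: (linear_differentiable (f := fL)).
exact: (diff_lin (f := fL)).
Qed.

Lemma is_diffE (V W : normedModType R) (f df : V -> W) (x : V) :
  is_diff x f df -> 'd f x = df :> (V -> W).
Proof. by move=> dfx; exact: diff_val. Qed.

Lemma is_diff_fst_coord (n k : nat) (z : 'rV[R]_n * 'rV[R]_k) (i : 'I_n) :
  is_diff z (fun w : 'rV[R]_n * 'rV[R]_k => w.1 0 i) (fun v => v.1 0 i).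
Proof.
apply: is_diff_linear; first by move=> a u v; rewrite !mxE.
move=> w; apply: (continuous_comp (f := fst) (g := fun x : 'rV[R]_n => x 0 i)).
  exact: cvg_fst.
exact: coord_continuous.
Qed.

Lemma is_diff_snd_coord (n k : nat) (z : 'rV[R]_n * 'rV[R]_k) (i : 'I_k) :
  is_diff z (fun w : 'rV[R]_n * 'rV[R]_k => w.2 0 i) (fun v => v.2 0 i).
Proof.
apply: is_diff_linear; first by move=> a u v; rewrite !mxE.
move=> w; apply: (continuous_comp (f := snd) (g := fun x : 'rV[R]_k => x 0 i)).
  exact: cvg_snd.
exact: coord_continuous.
Qed.

Lemma is_diff_sum (V W : normedModType R) (I : finType) (F dF : I -> V -> W)
    (x : V) :
  (forall i, is_diff x (F i) (dF i)) ->
  is_diff x (fun z => \sum_i F i z) (fun v => \sum_i dF i v).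
Proof.
move=> dFx.
have sumE (G : I -> V -> W) : (fun z => \sum_i G i z) = \sum_i G i.
  by apply/funext => z; rewrite fct_sumE.
rewrite !sumE; apply: (big_ind2 (fun G dG : V -> W => is_diff x G dG)).
- exact: (is_diff_cst (0 : W) x).
- by move=> G dG H dH; exact: is_diffD.
- by move=> i _.
Qed.

Lemma is_diff_coord_prod (n : nat) (z : 'rV[R]_n * 'rV[R]_n) (i : 'I_n) :
  is_diff z (fun w : 'rV[R]_n * 'rV[R]_n => w.1 0 i * w.2 0 i)
            (fun v => z.1 0 i * v.2 0 i + z.2 0 i * v.1 0 i).
Proof. exact: (is_diffM (is_diff_fst_coord z i) (is_diff_snd_coord z i)). Qed.

Lemma is_diff_inner (n : nat) (z : 'rV[R]_n * 'rV[R]_n) :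
  is_diff z (fun w : 'rV[R]_n * 'rV[R]_n => \sum_i w.1 0 i * w.2 0 i)
            (fun v => \sum_i (z.1 0 i * v.2 0 i + z.2 0 i * v.1 0 i)).
Proof. by apply: is_diff_sum => i; exact: is_diff_coord_prod. Qed.

(** Total differentiability of the objective is what makes its differential
    add up with that of the penalty term: ['d] is an unspecified linear map at
    points where a function is not differentiable. *)
Lemma differentiable_SPOcp_objective (n : nat) (f : 'rV[R]_n -> R)
    (pen : 'I_n -> R -> R) (z : 'rV[R]_n * 'rV[R]_n) :
  differentiable f z.1 -> (forall i t, derivable (pen i) t 1) ->
  differentiable (SPOcp_objective f pen) z.
Proof.
move=> df dpen.
have dfst : is_diff z (fst : 'rV[R]_n * 'rV[R]_n -> 'rV[R]_n) fst.
  by apply: is_diff_linear => // w; exact: cvg_fst.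
have dfz : differentiable (fun w : 'rV[R]_n * 'rV[R]_n => f w.1) z.
  by apply: (differentiable_comp (g := f)) => //; exact: (ex_diff (df := fst)).
apply: (differentiableD dfz).
pose q i (w : 'rV[R]_n * 'rV[R]_n) := pen i (w.2 0 i).
have /is_diff_sum ? : forall i, is_diff z (q i) ('d (q i) z).
  move=> i; apply: differentiableP.
  have ? := is_diff_snd_coord z i.
  apply: (differentiable_comp (g := pen i)); first exact: ex_diff.
  exact/derivable1_diffP.
exact: ex_diff.
Qed.

End differentials.

Lemma diff_Pen_objective (R : realType) (n m p : nat)
    (f : 'rV[R]_n -> R) (g : 'rV[R]_n -> 'rV[R]_m) (h : 'rV[R]_n -> 'rV[R]_p)
    (pen : 'I_n -> R -> R) (alpha : R) (z v : 'rV[R]_n * 'rV[R]_n) :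
  differentiable (SPOcp_objective f pen) z ->
  'd (objective (Pen f g h pen alpha)) z v =
    'd (SPOcp_objective f pen) z v
    + alpha * \sum_i (z.1 0 i * v.2 0 i + z.2 0 i * v.1 0 i).
Proof.
move=> dF; have dI := is_diffZ alpha (is_diff_inner z).
exact: (congr1 (@^~ v) (is_diffE (is_diffD (differentiableP dF) dI))).
Qed.

Unset Implicit Arguments.
Set Strict Implicit.

Theorem theorem6p3 (R : realType) (n m p : nat)
    (f : 'rV[R]_n -> R) (g : 'rV[R]_n -> 'rV[R]_m) (h : 'rV[R]_n -> 'rV[R]_p)
    (rho : R) (pen : 'I_n -> R -> R) (xs ys : 'rV[R]_n) :
  continuously_differentiable f ->
  continuously_differentiable g ->
  continuously_differentiable h ->
  0 < rho ->
  (forall i, penalty_conditions rho (pen i)) ->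
  stationary (SPOcp f g h pen) (xs, ys) ->
  exists alphas : R, 0 < alphas /\
    forall alpha : R, alphas <= alpha ->
      stationary (Pen f g h pen alpha) (xs, ys).
Proof.
move=> [df _] _ _ _ pencond [feasI feasE [lam [mu [lam_ge0 slack lagr]]]].
have dpen i t : derivable (pen i) t 1 by have [_ _ []] := pencond i.
have dF := @differentiable_SPOcp_objective R n f pen (xs, ys) (df _) dpen.
have dX i : 'd (ineq_constraint g (inr (inl i))) (xs, ys)
    = (fun v => - v.1 0 i) :> (_ -> R).
  exact: (is_diffE (is_diffN (is_diff_fst_coord (xs, ys) i))).
have dY i : 'd (ineq_constraint g (inr (inr i))) (xs, ys)
    = (fun v => - v.2 0 i) :> (_ -> R).
  exact: (is_diffE (is_diffN (is_diff_snd_coord (xs, ys) i))).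
have dXY i : 'd (fun w : 'rV[R]_n * 'rV[R]_n => w.1 0 i * w.2 0 i) (xs, ys)
    = (fun v => xs 0 i * v.2 0 i + ys 0 i * v.1 0 i) :> (_ -> R).
  exact: (is_diffE (is_diff_coord_prod (xs, ys) i)).
have x_ge0 i : 0 <= xs 0 i by rewrite -oppr_le0; exact: (feasI (inr (inl i))).
have y_ge0 i : 0 <= ys 0 i by rewrite -oppr_le0; exact: (feasI (inr (inr i))).
have xy0 i : xs 0 i * ys 0 i = 0 by exact: (feasE (inr i)).
pose gamma i := mu (inr i).
exists (1 + \sum_i `|gamma i|); split.
  by apply: ltr_pwDl => //; exact: sumr_ge0.
move=> alpha alpha_ge.
have gap_ge0 i : 0 <= alpha - gamma i.
  rewrite subr_ge0 (le_trans (ler_norm _)) // (le_trans _ alpha_ge) //.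
  by rewrite (bigD1 i) //= addrCA lerDl addr_ge0 // sumr_ge0.
split; [exact: feasI | by move=> j; exact: (feasE (inl j)) |].
exists (fun c => match c with
    | inl k => lam (inl k)
    | inr (inl i) => lam (inr (inl i)) + (alpha - gamma i) * ys 0 i
    | inr (inr i) => lam (inr (inr i)) + (alpha - gamma i) * xs 0 i
  end), (fun j => mu (inl j)).
split.
- by move=> [k|[i|i]] //; rewrite addr_ge0 // mulr_ge0.
- move=> [k|[i|i]]; first exact: (slack (inl k)).
  + have /= s := slack (inr (inl i)).
    by rewrite /= mulrDl s add0r mulrN -mulrA [ys 0 i * _]mulrC xy0 mulr0 oppr0.
  + have /= s := slack (inr (inr i)).
    by rewrite /= mulrDl s add0r mulrN -mulrA xy0 mulr0 oppr0.
- move=> v; rewrite diff_Pen_objective //.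
  have := lagr v; rewrite !big_sumType /= => lagr_v.
  (* With the new multipliers, the sign constraints and the penalty term
     together contribute what the sign and complementarity constraints
     contributed to the old Lagrangian. *)
  have absorb : alpha * (\sum_i (xs 0 i * v.2 0 i + ys 0 i * v.1 0 i))
      + (\sum_i (lam (inr (inl i)) + (alpha - gamma i) * ys 0 i)
           * 'd (ineq_constraint g (inr (inl i))) (xs, ys) v
         + \sum_i (lam (inr (inr i)) + (alpha - gamma i) * xs 0 i)
           * 'd (ineq_constraint g (inr (inr i))) (xs, ys) v)
    = (\sum_i lam (inr (inl i))
           * 'd (ineq_constraint g (inr (inl i))) (xs, ys) v
       + \sum_i lam (inr (inr i))
           * 'd (ineq_constraint g (inr (inr i))) (xs, ys) v)
      + \sum_i gamma i
           * 'd (fun w : 'rV[R]_n * 'rV[R]_n => w.1 0 i * w.2 0 i) (xs, ys) v.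
    rewrite mulr_sumr -!big_split /=; apply: eq_bigr => i _.
    by rewrite dX dY dXY; ring.
  by apply: etrans lagr_v; rewrite addrACA absorb; ring.
Qed.
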